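(* Let $m,n\in\mathbb{N}$ with $n\geq m$, and let $\mathbb{H}^m$ and $\mathbb{H}^n$ be endowed with left-invariant homogeneous distances $d$ and $d'$, respectively. If every infinite geodesic in $(\mathbb{H}^n,d')$ is a line, then every isometric embedding $f:(\mathbb{H}^m,d)\to(\mathbb{H}^n,d')$ is the composition of a left translation and a homogeneous homomorphism; that is, there exist $g\in\mathbb{H}^n$ and a homogeneous homomorphism $A:\mathbb{H}^m\to\mathbb{H}^n$ such that $f(p)=g\ast A(p)$ for all $p\in\mathbb{H}^m$.
   Context: For $n\geq 1$, the Heisenberg group $\mathbb{H}^n$ is the set $\mathbb{R}^{2n}\times\mathbb{R}$ with group law $(z,t)\ast(z',t')=(z+z',\,t+t'+2\omega_n(z,z'))$, where $\omega_n(z,z')=\langle z,J_nz'\rangle$, $J_n=\begin{pmatrix}0&-E_n\\ E_n&0\end{pmatrix}$ and $E_n$ is the $n\times n$ identity matrix. The neutral element is $e=(0,0)$ and $(z,t)^{-1}=(-z,-t)$. For $\lambda>0$ the dilation is $\delta_\lambda(z,t)=(\lambda z,\lambda^2t)$. A homogeneous norm on $\mathbb{H}^n$ is a function $N:\mathbb{H}^n\to[0,\infty)$ with $N(p)=0\Leftrightarrow p=e$, $N(p^{-1})=N(p)$, $N(p\ast q)\leq N(p)+N(q)$ and $N(\delta_\lambda(p))=\lambda N(p)$ for all $p,q\in\mathbb{H}^n$, $\lambda>0$. A left-invariant homogeneous distance on $\mathbb{H}^n$ is a metric of the form $d_N(p,q)=N(p^{-1}\ast q)$ for a homogeneous norm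 $N$. An isometric embedding is a distance-preserving map (not necessarily surjective). An infinite geodesic in a metric space $(X,d)$ is a map $\gamma:\mathbb{R}\to X$ with $d(\gamma(s),\gamma(s'))=|s-s'|$ for all $s,s'\in\mathbb{R}$. ''Line'' in $\mathbb{H}^n$ means a straight line in the underlying vector space $\mathbb{R}^{2n+1}$. A homogeneous homomorphism $A:\mathbb{H}^m\to\mathbb{H}^n$ is a group homomorphism with $A(\delta_\lambda(p))=\delta_\lambda(A(p))$ for all $\lambda>0$, $p\in\mathbb{H}^m$. *)

(* Defs.v *)
From mathcomp Require Import all_boot all_order all_algebra.
From mathcomp Require Import classical_sets reals.

Set Implicit Arguments.
Unset Strict Implicit.
Unset Printing Implicit Defensive.

Import Order.TTheory GRing.Theory Num.Theory.
Local Open Scope classical_set_scope.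
Local Open Scope ring_scope.

Definition heis (R : realType) (n : nat) : Type := ('cV[R]_(n + n) * R)%type.

Definition heis_J (R : realType) (n : nat) : 'M[R]_(n + n) :=
  block_mx 0 (- 1%:M) 1%:M 0.

Definition heis_omega (R : realType) (n : nat) (z z' : 'cV[R]_(n + n)) : R :=
  (z^T *m (heis_J R n *m z')) 0 0.

Definition heis_mul (R : realType) (n : nat) (p q : heis R n) : heis R n :=
  (p.1 + q.1, p.2 + q.2 + 2 * heis_omega p.1 q.1).

Definition heis_e (R : realType) (n : nat) : heis R n := (0, 0).

Definition heis_inv (R : realType) (n : nat) (p : heis R n) : heis R n :=
  (- p.1, - p.2).

Definition heis_dil (R : realType) (n : nat) (l : R) (p : heis R n) :
    heis R n :=
  (l *: p.1, l ^+ 2 * p.2).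

Record homogeneous_norm (R : realType) (n : nat) (N : heis R n -> R) : Prop := {
  hnorm_ge0 : forall p, 0 <= N p;
  hnorm_eq0 : forall p, N p = 0 <-> p = heis_e R n;
  hnorm_inv : forall p, N (heis_inv p) = N p;
  hnorm_mul : forall p q, N (heis_mul p q) <= N p + N q;
  hnorm_dil : forall (l : R) p, 0 < l -> N (heis_dil l p) = l * N p
}.

(* The axioms of a metric, as well as left invariance and homogeneity, follow
   from the axioms of a homogeneous norm. *)
Definition homogeneous_distance (R : realType) (n : nat)
    (d : heis R n -> heis R n -> R) : Prop :=
  exists2 N : heis R n -> R, homogeneous_norm N &
    forall p q, d p q = N (heis_mul (heis_inv p) q).

Definition isometric_embedding (R : realType) (X Y : Type)
    (d : X -> X -> R) (d' : Y -> Y -> R) (f : X -> Y) : Prop :=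
  forall p q, d' (f p) (f q) = d p q.

Definition infinite_geodesic (R : realType) (X : Type) (d : X -> X -> R)
    (gamma : R -> X) : Prop :=
  forall s s' : R, d (gamma s) (gamma s') = `|s - s'|.

(* A straight line of the vector space R^(2n) x R, not necessarily horizontal;
   the operations below are those of the vector space, not the group law. *)
Definition straight_line (R : realType) (n : nat) (L : set (heis R n)) : Prop :=
  exists p v : heis R n, v <> (0, 0) /\
    L = [set (p.1 + s *: v.1, p.2 + s * v.2) | s in [set: R]].

Definition homogeneous_homomorphism (R : realType) (m n : nat)
    (A : heis R m -> heis R n) : Prop :=
  (forall p q, A (heis_mul p q) = heis_mul (A p) (A q)) /\
  (forall (l : R) p, 0 < l -> A (heis_dil l p) = heis_dil l (A p)).

(* Main.v *)
Require Import Defs.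
From mathcomp Require Import all_boot all_order all_algebra.
From mathcomp Require Import classical_sets reals.
From mathcomp Require Import boolp.
From mathcomp Require Import ring lra.

Set Implicit Arguments.
Unset Strict Implicit.
Unset Printing Implicit Defensive.

Import Order.TTheory GRing.Theory Num.Theory.

Local Open Scope classical_set_scope.
Local Open Scope ring_scope.

(** Horizontal lines [s |-> p * (s v, 0)] are, up to speed, infinite geodesics
    for every homogeneous distance, so [f] sends them to infinite geodesics of
    the target, which are straight lines by hypothesis. Three observations then
    determine [f].

    A straight line that carries an infinite geodesic is horizontal
    ([geodesic_horizontal]). After a left translation it consists of the points
    [(u v, u x)], and these form a subgroup isomorphic to the real line. An
    isometric parametrization of this subgroup must be additive
    ([isometric_param_additive]), which makes the norm linear along it; but the
    norm of [(u v, u x)] is of order [sqrt u] as [u] tends to [0] unless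
    [x = 0]. Hence [f (p * (s v, 0)) = f p * (s w, 0)] for some [w]
    ([embedding_horizontal]).

    The velocity [w] does not depend on [p] ([horizontal_velocity_unique]): the
    points [p * (s v, 0)] and [q * (s v, 0)] are at distance [O(sqrt s)] from
    each other, because conjugating a point by [(s v, 0)] moves its last
    coordinate by [O(s)] only, whereas image lines with different velocities
    diverge linearly.

    So right multiplication by a horizontal point is turned by [f] into right
    multiplication by a point independent of the base point, compatibly with
    dilations. This property is stable under products ([translates_mul]), and
    horizontal points generate the group as soon as [m >= 1]
    ([horizontal_generation]); therefore it holds for all points, which says
    that [f] is a left translation composed with a homogeneous
    homomorphism. *)

(** * Algebra of the Heisenberg group *)

Section HeisenbergGroup.
Variables (R : realType) (n : nat).
Implicit Types (x y z : 'cV[R]_(n + n)) (p q r : heis R n) (s t : R).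

Definition horizontal z : heis R n := (z, 0).
Definition vertical t : heis R n := (0, t).

Lemma omegaDl x y z : heis_omega (x + y) z = heis_omega x z + heis_omega y z.
Proof. by rewrite /heis_omega linearD /= mulmxDl mxE. Qed.

Lemma omegaDr x y z : heis_omega x (y + z) = heis_omega x y + heis_omega x z.
Proof. by rewrite /heis_omega !mulmxDr mxE. Qed.

Lemma omegaZl s x y : heis_omega (s *: x) y = s * heis_omega x y.
Proof. by rewrite /heis_omega linearZ /= -scalemxAl mxE. Qed.

Lemma omegaZr s x y : heis_omega x (s *: y) = s * heis_omega x y.
Proof. by rewrite /heis_omega -!scalemxAr mxE. Qed.

Lemma omegaNl x y : heis_omega (- x) y = - heis_omega x y.
Proof. by rewrite -scaleN1r omegaZl mulN1r. Qed.

Lemma omegaNr x y : heis_omega x (- y) = - heis_omega x y.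
Proof. by rewrite -scaleN1r omegaZr mulN1r. Qed.

Lemma omega0l x : heis_omega 0 x = 0.
Proof. by rewrite -(scale0r 0) omegaZl mul0r. Qed.

Lemma omega0r x : heis_omega x 0 = 0.
Proof. by rewrite -(scale0r 0) omegaZr mul0r. Qed.

Lemma omega_self x : heis_omega x x = 0.
Proof.
have trJ : (heis_J R n)^T = - heis_J R n.
  rewrite /heis_J tr_block_mx opp_block_mx !trmx0 !oppr0 opprK.
  by rewrite linearN /= trmx1.
have : heis_omega x x = - heis_omega x x.
  rewrite {1}/heis_omega -[in LHS](trmxK (x^T *m _)) mxE.
  by rewrite !trmx_mul trmxK trJ mulmxN mulNmx mxE -mulmxA.
lra.
Qed.

Definition omegaE := (omegaDl, omegaDr, omegaZl, omegaZr, omegaNl, omegaNr,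
  omega0l, omega0r, omega_self).

Lemma heis_mulA p q r : heis_mul p (heis_mul q r) = heis_mul (heis_mul p q) r.
Proof.
by rewrite /heis_mul /=; congr pair; rewrite ?addrA // !omegaE; ring.
Qed.

Lemma heis_mule p : heis_mul p (heis_e R n) = p.
Proof. by case: p => z t; rewrite /heis_mul /= omegaE mulr0 !addr0. Qed.

Lemma heis_emul p : heis_mul (heis_e R n) p = p.
Proof. by case: p => z t; rewrite /heis_mul /= omegaE mulr0 !add0r addr0. Qed.

Lemma heis_mulVp p : heis_mul (heis_inv p) p = heis_e R n.
Proof.
by rewrite /heis_mul /heis_e /= !omegaE !addNr oppr0 mulr0 addr0.
Qed.

Lemma heis_mulpV p : heis_mul p (heis_inv p) = heis_e R n.
Proof.
by rewrite /heis_mul /heis_e /= !omegaE !subrr oppr0 mulr0 addr0.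
Qed.

Lemma heis_mulKp p q : heis_mul (heis_inv p) (heis_mul p q) = q.
Proof. by rewrite heis_mulA heis_mulVp heis_emul. Qed.

Lemma heis_mulVKp p q : heis_mul p (heis_mul (heis_inv p) q) = q.
Proof. by rewrite heis_mulA heis_mulpV heis_emul. Qed.

Lemma heis_invK p : heis_inv (heis_inv p) = p.
Proof. by case: p => z t; rewrite /heis_inv /= !opprK. Qed.

Lemma heis_invM p q :
  heis_inv (heis_mul p q) = heis_mul (heis_inv q) (heis_inv p).
Proof.
rewrite -[RHS](heis_mulKp (heis_mul p q)) -heis_mulA (heis_mulA q).
by rewrite heis_mulpV heis_emul heis_mulpV heis_mule.
Qed.

Lemma heis_dilM s p q :
  heis_dil s (heis_mul p q) = heis_mul (heis_dil s p) (heis_dil s q).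
Proof.
by rewrite /heis_dil /heis_mul /= scalerDr !omegaE; congr pair; ring.
Qed.

Lemma heis_dil1 p : heis_dil 1 p = p.
Proof. by case: p => z t; rewrite /heis_dil /= scale1r expr1n mul1r. Qed.

Lemma heis_dil_horizontal s z :
  heis_dil s (horizontal z) = horizontal (s *: z).
Proof. by rewrite /heis_dil /= mulr0. Qed.

Lemma heis_dil_vertical s t : heis_dil s (vertical t) = vertical (s ^+ 2 * t).
Proof. by rewrite /heis_dil /= scaler0. Qed.

Lemma heis_inv_horizontal z : heis_inv (horizontal z) = horizontal (- z).
Proof. by rewrite /heis_inv /= oppr0. Qed.

Lemma heis_split p : p = heis_mul (horizontal p.1) (vertical p.2).
Proof. by case: p => z t; rewrite /heis_mul /= !omegaE mulr0 !addr0 add0r. Qed.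

Lemma heis_ray_sub s t z u :
  heis_mul (heis_inv (s *: z, s * u)) (t *: z, t * u)
  = ((t - s) *: z, (t - s) * u).
Proof.
rewrite /heis_mul /heis_inv /= !omegaE.
by congr pair; [rewrite scalerBl addrC | ring].
Qed.

(** The deviation from [p] is central and depends linearly on [s], although
    the conjugating point is at distance [s] times a constant from the
    identity. *)
Lemma heis_conj_horizontal s z p :
  heis_mul (heis_inv (horizontal (s *: z))) (heis_mul p (horizontal (s *: z)))
  = heis_mul p (vertical (s * (2 * (heis_omega p.1 z - heis_omega z p.1)))).
Proof.
rewrite /heis_mul /heis_inv /= !omegaE.
by congr pair; [rewrite addrC addrK addr0 | ring].
Qed.

(** Left translations are affine maps, so a straight line read from one of its
    points is a line through the identity. *)
Lemma heis_translate_line p z u : exists x : R, forall s,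
  (p.1 + s *: z, p.2 + s * u) = heis_mul p (s *: z, s * x).
Proof.
exists (u - 2 * heis_omega p.1 z) => s.
by rewrite /heis_mul /= omegaZr; congr pair; ring.
Qed.

End HeisenbergGroup.

(** A nonzero value of the symplectic form makes the product of three
    horizontal points with zero total displacement an arbitrary vertical
    point. *)
Lemma horizontal_generation (R : realType) (n : nat) (P : heis R n -> Prop) :
  (1 <= n)%N ->
  (forall z, P (horizontal z)) ->
  (forall p q, P p -> P q -> P (heis_mul p q)) ->
  forall p, P p.
Proof.
case: n P => [//|n] P _ Phor Pmul p.
pose e : 'cV[R]_n.+1 := delta_mx 0 0.
pose x : 'cV[R]_(n.+1 + n.+1) := col_mx 0 e.
pose y : 'cV[R]_(n.+1 + n.+1) := col_mx e 0.
have xy1 : heis_omega x y = 1.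
  rewrite /heis_omega /heis_J mul_block_col tr_col_mx mul_row_col.
  rewrite trmx0 mul0mx add0r mulmx0 addr0 mul1mx trmx_delta mul_delta_mx.
  by rewrite mxE.
have vert (t : R) : P (vertical n.+1 t).
  pose u := (t / 2) *: x.
  have -> : vertical n.+1 t
      = heis_mul (heis_mul (horizontal u) (horizontal y))
                 (horizontal (- (u + y))).
    rewrite /heis_mul /= /vertical subrr; congr pair.
    by rewrite omegaNr omega_self omegaZl xy1; field.
  by apply: (Pmul _ _ (Pmul _ _ _ _)); apply: Phor.
by rewrite [p]heis_split; apply: Pmul (Phor _) (vert _).
Qed.

(** * Homogeneous norms *)

Section HomogeneousNorm.
Variables (R : realType) (n : nat) (N : heis R n -> R).
Hypothesis hN : homogeneous_norm N.
Implicit Types (z : 'cV[R]_(n + n)) (p q : heis R n) (s t : R).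

Lemma hnorm_e : N (heis_e R n) = 0.
Proof. by apply/(hnorm_eq0 hN). Qed.

Lemma hnorm_horizontalZ s z :
  N (horizontal (s *: z)) = `|s| * N (horizontal z).
Proof.
have pos t : 0 < t -> N (horizontal (t *: z)) = t * N (horizontal z).
  by move=> t0; rewrite -heis_dil_horizontal (hnorm_dil hN).
case: (ltrgt0P s) => [s0|s0|->]; first exact: pos.
- rewrite -(hnorm_inv hN) heis_inv_horizontal -scaleNr pos ?oppr_gt0 //.
- by rewrite scale0r mul0r; exact: hnorm_e.
Qed.

Lemma hnorm_horizontal_gt0 z : z <> 0 -> 0 < N (horizontal z).
Proof.
move=> z0; rewrite lt_def (hnorm_ge0 hN) andbT; apply/eqP.
by move/(hnorm_eq0 hN) => -[].
Qed.

Lemma hnorm_verticalM s t :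
  0 < s -> N (vertical n (s ^+ 2 * t)) = s * N (vertical n t).
Proof. by move=> s0; rewrite -heis_dil_vertical (hnorm_dil hN). Qed.

(** Conjugation by a horizontal point at distance [k ^ 2] has an effect of
    size [k] only; this is the sublinear divergence of parallel horizontal
    lines. *)
Lemma hnorm_conj_le z p : exists2 C : R, 0 <= C & forall k : R, 1 <= k ->
  N (heis_mul (heis_inv (horizontal (k ^+ 2 *: z)))
              (heis_mul p (horizontal (k ^+ 2 *: z)))) <= k * C.
Proof.
pose a := 2 * (heis_omega p.1 z - heis_omega z p.1).
have [Np0 Na0] := (hnorm_ge0 hN p, hnorm_ge0 hN (vertical n a)).
exists (N p + N (vertical n a)); first exact: addr_ge0.
move=> k k1; rewrite heis_conj_horizontal -/a.
apply: (le_trans (hnorm_mul hN _ _)).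
by rewrite hnorm_verticalM ?(lt_le_trans ltr01) //; nra.
Qed.

(** If the norm is linear on integer multiples along a one-parameter subgroup,
    then [sqrt k * N (0, x) <= N (z, x) + N (z, 0)] for every square [k]: the
    point [(z / k, x / k)] has norm of order [1 / k], while its vertical part
    alone has norm of order [1 / sqrt k]. *)
Lemma hnorm_linear_ray z (x : R) :
  (forall (k : nat) (u : R), N ((k%:R * u) *: z, k%:R * u * x)
     = k%:R * N (u *: z, u * x)) ->
  x = 0.
Proof.
move=> lin.
pose C := N (z, x) + N (horizontal z).
have bound (j : nat) : j.+1%:R * N (vertical n x) <= C.
  have J0 : 0 < (j.+1%:R : R) by rewrite ltr0n.
  set J : R := j.+1%:R in J0 *.
  have J2 : J ^+ 2 = (j.+1 ^ 2)%N%:R by rewrite natrX.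
  have Jn0 : J != 0 by rewrite gt_eqF.
  pose u := (J ^+ 2)^-1.
  have Ju : J ^+ 2 * u = 1 by rewrite divff // expf_neq0.
  have := lin (j.+1 ^ 2)%N u; rewrite -J2 Ju scale1r mul1r => Nu.
  have vertE : vertical n (u * x)
      = heis_mul (heis_inv (horizontal (u *: z))) (u *: z, u * x).
    rewrite /heis_mul /= !omegaE addNr /vertical; congr pair; ring.
  have := hnorm_mul hN (heis_inv (horizontal (u *: z))) (u *: z, u * x).
  rewrite -vertE (hnorm_inv hN) hnorm_horizontalZ ger0_norm; last first.
    by rewrite invr_ge0 exprn_ge0 // ltW.
  have -> : u = J^-1 ^+ 2 by rewrite /u exprVn.
  rewrite hnorm_verticalM ?invr_gt0 // exprVn -/u => le_u.
  have J2p : 0 <= J ^+ 2 by rewrite exprn_ge0 // ltW.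
  have -> : J * N (vertical n x) = J ^+ 2 * (J^-1 * N (vertical n x)).
    by rewrite mulrA expr2 mulfK.
  apply: (le_trans (ler_wpM2l J2p le_u)).
  by rewrite mulrDr mulrA Ju mul1r -Nu addrC.
have V0 := hnorm_ge0 hN (vertical n x).
have : N (vertical n x) = 0.
  apply/eqP; rewrite eq_le V0 andbT leNgt; apply/negP => Vp.
  have C0 : 0 <= C by rewrite addr_ge0 ?(hnorm_ge0 hN).
  have := archi_boundP (divr_ge0 C0 V0); rewrite ltr_pdivrMr // => lt_C.
  have := le_lt_trans (bound (Num.bound (C / N (vertical n x)))) lt_C.
  by rewrite (ltr_pM2r Vp) ltr_nat ltnNge leqnSn.
by move/(hnorm_eq0 hN) => -[].
Qed.

End HomogeneousNorm.

(** * Infinite geodesics carried by straight lines *)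

(** With [sigma r = sigma s + sigma t], invariance of the distance under
    translations gives [|r - s| = |t|] and [|r - t| = |s|], which leaves only
    [r = s + t], or [s = t] and [r = 0]; in the latter case [sigma s = 0], so
    that [s = 0] as well. *)
Lemma isometric_param_additive (R : realType) (g sigma : R -> R) :
  (forall y, exists t, sigma t = y) ->
  sigma 0 = 0 ->
  (forall s t, g (sigma t - sigma s) = `|t - s|) ->
  forall s t, sigma (s + t) = sigma s + sigma t.
Proof.
move=> surj s0 iso s t.
have [r rE] := surj (sigma s + sigma t).
have rs : `|r - s| = `|t|.
  by rewrite -iso rE addrAC subrr add0r -[t in RHS]subr0 -iso s0 subr0.
have rt : `|r - t| = `|s|.
  by rewrite -iso rE addrK -[s in RHS]subr0 -iso s0 subr0.
have [rst|[r0 st]] : r = s + t \/ r = 0 /\ s = t.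
- move/eqP: rs; move/eqP: rt; rewrite !eqr_norm2.
  by move=> /orP[]/eqP rt /orP[]/eqP rs; [left|left|left|right; split]; lra.
- by rewrite -rst.
have s00 : sigma s = 0 by move: rE; rewrite r0 s0 -st; lra.
suff -> : s = 0 by rewrite add0r s0 add0r.
apply/eqP; rewrite -normr_eq0 -[s]subr0 -iso s00 s0 -[X in _ - X]s0.
by rewrite -[X in X - _]s0 iso subrr normr0.
Qed.

(** The condition at [0] gives [c * sigma t = t] or [- t]; the condition at [1]
    makes the sign the same for all [t]. *)
Lemma expanding_param_linear (R : realType) (c : R) (sigma : R -> R) :
  0 < c -> sigma 0 = 0 ->
  (forall s t, c * `|sigma t - sigma s| = `|t - s|) ->
  exists a, forall t, sigma t = t * a.
Proof.
move=> c0 s0 iso; exists (sigma 1) => t.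
have norm_c x : c * `|x| = `|c * x| by rewrite normrM gtr0_norm.
have dist0 r : c * sigma r = r \/ c * sigma r = - r.
  have /eqP := iso 0 r; rewrite s0 !subr0 norm_c eqr_norm2.
  by move=> /orP[]/eqP; [left|right].
have /eqP := iso 1 t; rewrite norm_c eqr_norm2 mulrBr.
move=> /orP dist1; apply: (mulfI (lt0r_neq0 c0)).
rewrite mulrCA; case: (dist0 t) dist1 => ->; case: (dist0 1) => ->.
- by rewrite mulr1.
- move=> []/eqP e; first lra.
  suff -> : t = 0 by rewrite mul0r.
  lra.
- move=> []/eqP e; last lra.
  suff -> : t = 0 by rewrite mul0r oppr0.
  lra.
- by rewrite mulrN1.
Qed.

(** * Affine structure of the embedding *)

(** Seen from [gamma 0] the line consists of the points [(y z, y x)], whose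
    mutual distances depend only on the differences of the parameters [y].
    Additivity of the parametrization makes the distance scale linearly with
    [y], and [hnorm_linear_ray] then gives [x = 0]. *)
Lemma geodesic_horizontal (R : realType) (n : nat)
    (d : heis R n -> heis R n -> R) (gamma : R -> heis R n) :
  homogeneous_distance d ->
  infinite_geodesic d gamma ->
  straight_line (range gamma) ->
  exists w, forall s, gamma s = heis_mul (gamma 0) (horizontal (s *: w)).
Proof.
move=> [N hN dE] geo [p [[z u] [/= zu0 rangeE]]].
have [s0 _ s0E] : [set (p.1 + s *: z, p.2 + s * u) | s in [set: R]] (gamma 0).
  by rewrite -rangeE; exists 0.
have [x line] := heis_translate_line (gamma 0) z u.
have baseE s : (p.1 + s *: z, p.2 + s * u)
    = heis_mul (gamma 0) ((s - s0) *: z, (s - s0) * x).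
  rewrite -line -s0E /=; congr pair; last by ring.
  by rewrite -addrA -scalerDl (addrC s0) subrK.
have zx0 : (z, x) <> (0, 0).
  move=> [z0 x0]; apply: zu0; have := line 1.
  rewrite z0 x0 !scaler0 mulr0 -/(heis_e R n) heis_mule mul1r addr0.
  by case: (gamma 0) => y t /= [] ?; congr pair; lra.
have param t : exists s, gamma t = heis_mul (gamma 0) (s *: z, s * x).
  have : range gamma (gamma t) by exists t.
  by rewrite rangeE => -[s _ sE]; exists (s - s0); rewrite -baseE sE.
have [sigma sigmaE] := choice param.
pose g y := N (y *: z, y * x).
have iso s t : g (sigma t - sigma s) = `|t - s|.
  rewrite distrC -geo dE (sigmaE s) (sigmaE t) heis_invM -heis_mulA heis_mulKp.
  by rewrite heis_ray_sub.
have ray_inj a b : a *: z = b *: z -> a * x = b * x -> a = b.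
  move=> /eqP; rewrite -subr_eq0 -scalerBl scaler_eq0 => /orP[|/eqP z0].
    by rewrite subr_eq0 => /eqP.
  move=> /eqP; rewrite -subr_eq0 -mulrBl mulf_eq0 => /orP[|/eqP x0].
    by rewrite subr_eq0 => /eqP.
  by case: zx0; rewrite z0 x0.
have mul_inj p1 q1 q2 : heis_mul p1 q1 = heis_mul p1 q2 -> q1 = q2.
  by move=> e; rewrite -[q1](heis_mulKp p1) e heis_mulKp.
have sigma0 : sigma 0 = 0.
  have := sigmaE 0; rewrite -{1}[gamma 0]heis_mule => /mul_inj [] e1 e2.
  by apply: ray_inj; rewrite -?e1 -?e2 ?scale0r ?mul0r.
have surj y : exists t, sigma t = y.
  have : range gamma (heis_mul (gamma 0) (y *: z, y * x)).
    by rewrite rangeE; exists (y + s0) => //; rewrite baseE addrK.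
  by move=> [t _]; rewrite sigmaE => /mul_inj [] *; exists t; apply: ray_inj.
have sigmaD := isometric_param_additive surj sigma0 iso.
have sigmaM (k : nat) t : sigma (k%:R * t) = k%:R * sigma t.
  elim: k => [|k IHk]; first by rewrite !mul0r.
  by rewrite -natr1 !mulrDl !mul1r sigmaD IHk.
have gE t : g (sigma t) = `|t| by rewrite -[sigma t]subr0 -sigma0 iso subr0.
have x0 : x = 0.
  apply: (hnorm_linear_ray hN (z := z)) => k y; have [t <-] := surj y.
  by rewrite -/(g _) -/(g _) -sigmaM !gE normrM normr_nat.
have z0 : z <> 0 by move=> z0; apply: zx0; rewrite z0 x0.
have [a aE] : exists a, forall t, sigma t = t * a.
  apply: (expanding_param_linear (hnorm_horizontal_gt0 hN z0)) => // s t.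
  by rewrite mulrC -(hnorm_horizontalZ hN) -iso /g x0 mulr0.
exists (a *: z) => s.
by rewrite (sigmaE s) aE x0 mulr0 scalerA.
Qed.

Section Embedding.
Variables (R : realType) (m n : nat).
Variables (N : heis R m -> R) (N' : heis R n -> R).
Hypotheses (hN : homogeneous_norm N) (hN' : homogeneous_norm N').
Let d p q := N (heis_mul (heis_inv p) q).
Let d' p q := N' (heis_mul (heis_inv p) q).
Hypothesis hline : forall gamma : R -> heis R n,
  infinite_geodesic d' gamma -> straight_line (range gamma).
Variable f : heis R m -> heis R n.
Hypothesis hf : isometric_embedding d d' f.

Lemma embedding_horizontal p v : exists w, forall s,
  f (heis_mul p (horizontal (s *: v))) = heis_mul (f p) (horizontal (s *: w)).
Proof.
have [->|/eqP v0] := eqVneq v 0.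
  by exists 0 => s; rewrite !scaler0 !heis_mule.
have c0 := hnorm_horizontal_gt0 hN v0; set c := N _ in c0.
have cn0 := lt0r_neq0 c0.
pose gamma s := f (heis_mul p (horizontal ((s / c) *: v))).
have geo : infinite_geodesic d' gamma.
  move=> s t; rewrite hf /d heis_invM -heis_mulA heis_mulKp.
  have -> : heis_mul (heis_inv (horizontal ((s / c) *: v)))
      (horizontal ((t / c) *: v)) = horizontal (((t - s) / c) *: v).
    rewrite /heis_mul /heis_inv /= !omegaE /horizontal.
    by congr pair; [rewrite mulrBl scalerBl addrC | ring].
  rewrite (hnorm_horizontalZ hN) -/c normrM normfV (gtr0_norm c0).
  by rewrite mulfVK // distrC.
have hd' : homogeneous_distance d' by exists N'.
have [w wE] := geodesic_horizontal hd' geo (hline geo).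
exists (c *: w) => s; have := wE (s * c).
rewrite /gamma mulfK // mul0r scale0r -/(heis_e R m) heis_mule => ->.
by rewrite scalerA.
Qed.

(** At time [k ^ 2] the two points of the source are at distance [O(k)], and
    so are their images. In the target, replacing the starting point [f q] by
    [f p] also costs [O(k)] only. Thus points running from [f p] with
    velocities [w] and [w'] are at distance [O(k)] at time [k ^ 2], although
    this distance is [k ^ 2] times a constant. *)
Lemma horizontal_velocity_unique p q v w w' :
  (forall s, f (heis_mul p (horizontal (s *: v)))
     = heis_mul (f p) (horizontal (s *: w))) ->
  (forall s, f (heis_mul q (horizontal (s *: v)))
     = heis_mul (f q) (horizontal (s *: w'))) ->
  w = w'.
Proof.
move=> wE w'E.
pose D := heis_mul (heis_inv (horizontal w)) (horizontal w').
have [C C0 srcC] := hnorm_conj_le hN v (heis_mul (heis_inv p) q).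
have [C' C'0 tgtC] := hnorm_conj_le hN' w' (heis_mul (heis_inv (f p)) (f q)).
have bound k : 1 <= k -> k ^+ 2 * N' D <= k * (C + C').
  move=> k1; have k0 : 0 < k by apply: lt_le_trans k1.
  have k20 : 0 < k ^+ 2 by rewrite exprn_gt0.
  have {srcC} := srcC k k1; have {tgtC} := tgtC k k1.
  set h := horizontal (k ^+ 2 *: w'); set h0 := horizontal (k ^+ 2 *: v).
  set b := heis_mul (heis_inv h) _ => leb.
  have -> : heis_mul (heis_inv h0) (heis_mul (heis_mul (heis_inv p) q) h0)
      = heis_mul (heis_inv (heis_mul p h0)) (heis_mul q h0).
    by rewrite heis_invM !heis_mulA.
  rewrite -/(d _ _) -hf wE w'E => lea.
  rewrite -(hnorm_dil hN') // heis_dilM.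
  have -> : heis_dil (k ^+ 2) (heis_inv (horizontal w))
      = heis_inv (horizontal (k ^+ 2 *: w)).
    by rewrite !heis_inv_horizontal heis_dil_horizontal scalerN.
  rewrite heis_dil_horizontal -/h.
  have -> : heis_mul (heis_inv (horizontal (k ^+ 2 *: w))) h
      = heis_mul
          (heis_mul (heis_inv (heis_mul (f p) (horizontal (k ^+ 2 *: w))))
                    (heis_mul (f q) h)) (heis_inv b).
    have -> : b = heis_mul (heis_inv (heis_mul (f p) h)) (heis_mul (f q) h).
      by rewrite heis_invM /b !heis_mulA.
    rewrite (heis_invM (heis_inv _)) heis_invK -heis_mulA heis_mulVKp.
    by rewrite heis_invM -heis_mulA heis_mulKp.
  apply: (le_trans (hnorm_mul hN' _ _)); rewrite (hnorm_inv hN').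
  by rewrite mulrDr; apply: lerD.
have ND : N' D = 0.
  apply/eqP; rewrite eq_le (hnorm_ge0 hN') andbT leNgt; apply/negP => D0.
  (* For this k, division of the bound by k gives C + C' + N' D <= C + C'. *)
  have k1 : 1 <= (C + C') / N' D + 1
    by rewrite lerDr divr_ge0 ?addr_ge0 // ltW.
  have := bound _ k1; rewrite expr2 -mulrA ler_pM2l ?(lt_le_trans ltr01 k1) //.
  by rewrite mulrDl divfK ?lt0r_neq0 // mul1r gerDl leNgt D0.
move/(hnorm_eq0 hN'): ND; rewrite /D /heis_mul /= => -[/eqP].
by rewrite addrC subr_eq0 => /eqP ->.
Qed.

(** Asking for one [h] that serves all base points makes the property stable
    under products and [f] multiplicative up to a translation; asking that it
    serve all scales gives compatibility with dilations. *)
Definition translates p := exists h, forall l q, 0 < l ->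
  f (heis_mul q (heis_dil l p)) = heis_mul (f q) (heis_dil l h).

Lemma translates_horizontal v : translates (horizontal v).
Proof.
have [w wE] := embedding_horizontal (heis_e R m) v.
exists (horizontal w) => l q _; rewrite !heis_dil_horizontal.
have [w' w'E] := embedding_horizontal q v.
by rewrite (horizontal_velocity_unique wE w'E).
Qed.

Lemma translates_mul p q : translates p -> translates q ->
  translates (heis_mul p q).
Proof.
move=> [h hE] [k kE]; exists (heis_mul h k) => l r l0.
by rewrite !heis_dilM !heis_mulA kE // hE.
Qed.

End Embedding.

Theorem theorem1p1 (R : realType) (m n : nat) (hm : (1 <= m)%N)
    (hmn : (m <= n)%N)
    (d : heis R m -> heis R m -> R) (d' : heis R n -> heis R n -> R)
    (hd : homogeneous_distance d) (hd' : homogeneous_distance d')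
    (hline : forall gamma : R -> heis R n,
       infinite_geodesic d' gamma -> straight_line (range gamma))
    (f : heis R m -> heis R n) (hf : isometric_embedding d d' f) :
  exists (g : heis R n) (A : heis R m -> heis R n),
    homogeneous_homomorphism A /\ forall p, f p = heis_mul g (A p).
Proof.
case: hd hd' => N hN dE [N' hN' d'E].
have {dE} dE : d = fun p q => N (heis_mul (heis_inv p) q) by apply/eq2_fun.
have {d'E} d'E : d' = fun p q => N' (heis_mul (heis_inv p) q) by apply/eq2_fun.
subst d d'.
have transl : forall p, translates f p.
  apply: horizontal_generation => //.
    exact: (translates_horizontal hN hN').
  exact: translates_mul.
have [A AE] := choice transl.
have fM p q : f (heis_mul p q) = heis_mul (f p) (A q).
  by have := AE q 1 p ltr01; rewrite !heis_dil1.
have fE p : f p = heis_mul (f (heis_e R m)) (A p) by rewrite -fM heis_emul.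
exists (f (heis_e R m)), A; split=> //.
have AfE p : A p = heis_mul (heis_inv (f (heis_e R m))) (f p).
  by rewrite [f p]fE heis_mulKp.
split=> [p q|l p l0].
- by rewrite [LHS]AfE fM heis_mulA -AfE.
- by rewrite [LHS]AfE -[heis_dil l p]heis_emul AE // heis_mulKp.
Qed.
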